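(* Let $m$ be an odd positive integer and let $\mathcal{H}_m:=\{\langle\sigma_{2m}^m\rangle,\langle\tau_{2m}\rangle\}$, a set of subgroups of $D_{2m}$. Then the $D_{2m}$-lattice $J_{D_{2m}/\mathcal{H}_m}$ is quasi-permutation.
   Context: $D_{n}:=\langle\sigma_n,\tau_n\mid\sigma_n^n=\tau_n^2=1,\ \tau_n\sigma_n\tau_n^{-1}=\sigma_n^{-1}\rangle$ is the dihedral group of order $2n$; here $n=2m$. A $G$-lattice is a finitely generated free abelian group with left $G$-action; $M^\circ:=\mathrm{Hom}_{\mathbb{Z}}(M,\mathbb{Z})$ with $(gf)(x)=f(g^{-1}x)$. Permutation: has a $\mathbb{Z}$-basis permuted by $G$; quasi-permutation: there is an exact sequence $0\to M\to R\to F\to0$ with $R,F$ permutation. For a set $\mathcal{H}$ of subgroups, $I_{G/\mathcal{H}}:=\ker(\bigoplus_{H\in\mathcal{H}}\mathbb{Z}[G/H]\to\mathbb{Z})$ (sum of augmentation maps) and $J_{G/\mathcal{H}}:=I_{G/\mathcal{H}}^\circ$. *)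

(* Defs.v *)
(* G-lattices are modelled concretely: a G-lattice of rank r is
   Z^r (column vectors 'cV[int]_r) with a left action given by integer matrices
   rho g, g acting on x by rho g *m x. *)
From HB Require Import structures.
From mathcomp Require Import all_boot all_order all_algebra all_fingroup.
Set Implicit Arguments.
Unset Strict Implicit.
Unset Printing Implicit Defensive.
Import GRing.Theory Num.Theory.
Local Open Scope ring_scope.

Section GLattices.
Variable gT : finGroupType.
Implicit Types G H : {group gT}.

Definition is_glattice (G : {group gT}) r (rho : gT -> 'M[int]_r) : Prop :=
  rho 1%g = 1%:M /\
  (forall g h, g \in G -> h \in G -> rho (g * h)%g = rho g *m rho h).

Definition equivariant (G : {group gT}) r1 r2 (rho1 : gT -> 'M[int]_r1)
  (rho2 : gT -> 'M[int]_r2) (A : 'M[int]_(r2, r1)) : Prop :=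
  forall g, g \in G -> A *m rho1 g = rho2 g *m A.

(* Permutation lattice: there is a Z-basis (the columns of a unimodular P)
   which is permuted by every element of G. *)
Definition is_permutation (G : {group gT}) r (rho : gT -> 'M[int]_r) : Prop :=
  is_glattice G rho /\
  exists P : 'M[int]_r, P \in unitmx /\
    forall g, g \in G -> is_perm_mx (invmx P *m rho g *m P).

Definition is_quasi_permutation (G : {group gT}) r (rho : gT -> 'M[int]_r)
  : Prop :=
  is_glattice G rho /\
  exists (n1 n2 : nat) (R : gT -> 'M[int]_n1) (F : gT -> 'M[int]_n2)
         (A : 'M[int]_(n1, r)) (B : 'M[int]_(n2, n1)),
    [/\ is_permutation G R, is_permutation G F,
        equivariant G rho R A & equivariant G R F B] /\
    [/\ (forall y : 'cV[int]_r, A *m y = 0 -> y = 0),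
        (forall z : 'cV[int]_n2, exists x : 'cV[int]_n1, z = B *m x) &
        (forall x : 'cV[int]_n1, B *m x = 0 <-> exists y, x = A *m y)].

(* Dual lattice M° = Hom(M,Z) with (g f)(x) = f(g^-1 x); in coordinates
   (dual basis) the action matrix is the transpose of rho (g^-1). *)
Definition dual_lattice r (rho : gT -> 'M[int]_r) : gT -> 'M[int]_r :=
  fun g => (rho (g^-1)%g)^T.

(* Basis of (+)_{H in Hs} Z[G/H]: pairs (i, C) with C a left coset of the
   i-th subgroup of Hs in G. *)
Definition coset_basis (G : {group gT}) (Hs : seq {group gT})
  : {set ('I_(size Hs) * {set gT})} :=
  [set p : 'I_(size Hs) * {set gT} | p.2 \in lcosets (nth 1%G Hs (nat_of_ord p.1)) G].

Definition coset_rank (G : {group gT}) (Hs : seq {group gT}) : nat :=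
  #|coset_basis G Hs|.

Definition coset_action (G : {group gT}) (Hs : seq {group gT}) (g : gT)
  : 'M[int]_(coset_rank G Hs) :=
  \matrix_(a, b)
    ((enum_val a == ((enum_val b).1, (g *: (enum_val b).2)%g)) : nat)%:R.

Definition coset_aug (G : {group gT}) (Hs : seq {group gT})
  : 'rV[int]_(coset_rank G Hs) := const_mx 1.

(* (r, rho) is (a coordinate presentation of) I_{G/Hs}: it is a G-lattice
   embedded equivariantly and injectively into (+)_H Z[G/H] with image exactly
   the kernel of the augmentation. *)
Definition is_I_lattice (G : {group gT}) (Hs : seq {group gT}) r
  (rho : gT -> 'M[int]_r) : Prop :=
  is_glattice G rho /\
  exists A : 'M[int]_(coset_rank G Hs, r),
    [/\ equivariant G rho (coset_action G Hs) A,
        (forall y : 'cV[int]_r, A *m y = 0 -> y = 0) &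
        (forall x : 'cV[int]_(coset_rank G Hs),
            coset_aug G Hs *m x = 0 <-> exists y, x = A *m y)].

End GLattices.

(* Main.v *)
(* Dually, it suffices to find a permutation lattice R mapping onto I_{G/Hs} with
   permutation kernel F.  Put z = s^m, a central element of order 2, V = <t, z> and
   h = s^((m+1)/2), so that h^2 = sz.  Filtering I_{G/Hs} by the
   lattice induced from I_{V/{<z>,<t>}}, with quotient I_{G/V}, leads to
     0 -> Z[G/<tz>] + Z[G/V] + Z[G/<s>]
       -> Z[G] + Z[G/V] + Z[G/<z>] + Z -> I_{G/Hs} -> 0.
   The induced part is resolved by 0 -> Z[G/<tz>] -> Z[G] + Z[G/V], and I_{G/V},
   generated by hV - thV, by Z[G/V] + Z[G/<s>] -> Z[G/<z>] + Z; the extra Z is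
   available because the indices m of V and 2 of <s> are coprime. *)
Require Import Defs.
From HB Require Import structures.
From mathcomp Require Import all_boot all_order all_algebra all_fingroup.
From mathcomp Require Import cyclic ring zify.
Set Implicit Arguments.
Unset Strict Implicit.
Unset Printing Implicit Defensive.
Import GRing.Theory.
Local Open Scope ring_scope.

(** * Matrices and linear maps on column vectors *)

Lemma mulmx_colP (R : pzRingType) m n (A B : 'M[R]_(m, n)) :
  (forall x : 'cV[R]_n, A *m x = B *m x) -> A = B.
Proof.
move=> AB; apply/matrixP => i j.
by have := AB (delta_mx j 0); rewrite -!colE => /colP/(_ i); rewrite !mxE.
Qed.

(** Preimages of the basis vectors serve as the columns of [C]; surjectivity and exactness thus
    become matrix factorizations. *)
Lemma col_factor (R : pzRingType) m n p (A : 'M[R]_(m, n)) (B : 'M[R]_(m, p)) :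
  (forall x : 'cV[R]_p, exists y : 'cV[R]_n, B *m x = A *m y) ->
  exists C : 'M[R]_(n, p), B = A *m C.
Proof.
move=> AB; have /fin_all_exists [c cP] (j : 'I_p) := AB (delta_mx j 0).
exists (\matrix_(i, j) c j i 0); apply/matrixP => i j.
have := cP j; rewrite -colE => /colP/(_ i); rewrite !mxE => ->.
by apply: eq_bigr => k _; rewrite !mxE.
Qed.

Lemma linear_colP (R : comNzRingType) m n (f : 'cV[R]_n -> 'cV[R]_m) :
  linear f -> exists A : 'M[R]_(m, n), forall x, A *m x = f x.
Proof.
move=> fL; pose L := GRing.isLinear.Build _ _ _ _ f fL.
pose F : {linear _ -> _} := HB.pack f L.
exists (\matrix_(i, j) F (delta_mx j 0) i 0) => x.
apply/colP => i; rewrite mxE.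
rewrite -[f x]/(F x) [in RHS](matrix_sum_delta x) linear_sum summxE.
apply: eq_bigr => j _; rewrite big_ord1 linearZ !mxE mulrC.
by [].
Qed.

(** * Dualizing short exact sequences of lattices *)

Section DualSequence.
Variables (gT : finGroupType) (G : {group gT}).

Lemma dual_glattice r (rho : gT -> 'M[int]_r) :
  is_glattice G rho -> is_glattice G (dual_lattice rho).
Proof.
rewrite /dual_lattice => -[rho1 rhoM]; split=> [|g h Gg Gh].
  by rewrite invg1 rho1 trmx1.
by rewrite invMg rhoM ?groupV // trmx_mul.
Qed.

Lemma dual_equivariant r1 r2 (rho1 : gT -> 'M[int]_r1) (rho2 : gT -> 'M[int]_r2) A :
  equivariant G rho1 rho2 A ->
  equivariant G (dual_lattice rho2) (dual_lattice rho1) A^T.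
Proof.
move=> eqA g Gg; rewrite /dual_lattice -!trmx_mul.
by congr trmx; apply/esym/eqA; rewrite groupV.
Qed.

(* The sequence splits over Z, so its transpose is again exact. *)
Lemma dual_quasi_permutation r nR nF (rho : gT -> 'M[int]_r)
    (R : gT -> 'M[int]_nR) (F : gT -> 'M[int]_nF)
    (P : 'M[int]_(r, nR)) (N : 'M[int]_(nR, nF)) :
  is_glattice G rho ->
  is_permutation G (dual_lattice R) -> is_permutation G (dual_lattice F) ->
  equivariant G R rho P -> equivariant G F R N ->
  (forall y : 'cV[int]_r, exists x : 'cV[int]_nR, y = P *m x) ->
  (forall w : 'cV[int]_nF, N *m w = 0 -> w = 0) ->
  (forall x : 'cV[int]_nR, P *m x = 0 <-> exists w, x = N *m w) ->
  is_quasi_permutation G (dual_lattice rho).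
Proof.
move=> lat_rho permR permF eqvP eqvN surjP injN exPN.
have PN0 : P *m N = 0.
  apply: mulmx_colP => w; rewrite -mulmxA mul0mx.
  by apply/exPN; exists w.
have [S PS] : exists S, 1%:M = P *m S.
  by apply: col_factor => y; rewrite mul1mx; apply: surjP.
(* The idempotent [1 - S P] projects onto the kernel of [P], hence factors through [N]; the cofactor
   [T] is a retraction of [N]. *)
have [T NT] : exists T, 1%:M - S *m P = N *m T.
  apply: col_factor => x; apply/exPN.
  by rewrite mulmxBl mul1mx mulmxBr !mulmxA -PS mul1mx subrr.
have TN : T *m N = 1%:M.
  apply: mulmx_colP => w; apply/eqP; rewrite -subr_eq0; apply/eqP/injN.
  rewrite mulmxBr mul1mx !mulmxA -NT mulmxBl mul1mx -(mulmxA S) PN0.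
  by rewrite mulmx0 subr0 subrr.
split; first exact: dual_glattice.
exists nR, nF, (dual_lattice R), (dual_lattice F), P^T, N^T.
split; first by split=> //; apply: dual_equivariant.
split=> [y Py0 | z | x].
- by rewrite -(mul1mx y) -trmx1 PS trmx_mul -mulmxA Py0 mulmx0.
- by exists (T^T *m z); rewrite mulmxA -trmx_mul TN trmx1 mul1mx.
split=> [Nx0 | [y ->]]; last by rewrite mulmxA -trmx_mul PN0 trmx0 mul0mx.
exists (S^T *m x); rewrite mulmxA -trmx_mul.
apply/eqP; rewrite -subr_eq0 -{1}(mul1mx x) -mulmxBl -{1}trmx1 -linearB /= NT.
by rewrite trmx_mul -mulmxA Nx0 mulmx0.
Qed.

End DualSequence.

(** * Coset lattices and their coefficient functions on [G] *)

Section CosetLattice.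
Variables (gT : finGroupType) (G : {group gT}).
Implicit Types (Hs : seq {group gT}) (g k : gT).

Lemma coset_act_eq Hs g (p q : 'I_(size Hs) * {set gT}) :
  (p == (q.1, (g *: q.2)%g)) = (q == (p.1, (g^-1 *: p.2)%g)).
Proof.
case: p q => [i A] [j B] /=; rewrite -!pair_eqE /= eq_sym; congr andb.
by apply/eqP/eqP => ->; rewrite (lcosetK, lcosetKV).
Qed.

Lemma coset_basis_act Hs g (p : 'I_(size Hs) * {set gT}) : g \in G ->
  p \in coset_basis G Hs -> (p.1, (g *: p.2)%g) \in coset_basis G Hs.
Proof.
rewrite !inE /= => Gg /lcosetsP [x Gx ->]; apply/lcosetsP.
by exists (g * x)%g; rewrite ?groupM // lcosetM.
Qed.

Definition coset_val Hs (a : 'I_(coset_rank G Hs)) : 'I_(size Hs) * {set gT} :=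
  enum_val a.

Lemma coset_val_inj Hs : injective (@coset_val Hs).
Proof. exact: enum_val_inj. Qed.

Lemma coset_valP Hs (a : 'I_(coset_rank G Hs)) : coset_val a \in coset_basis G Hs.
Proof. exact: enum_valP. Qed.

Lemma coset_basis_index Hs (p : 'I_(size Hs) * {set gT}) :
  p \in coset_basis G Hs -> exists a : 'I_(coset_rank G Hs), coset_val a = p.
Proof. by move=> pP; exists (enum_rank_in pP p); rewrite /coset_val enum_rankK_in. Qed.

Lemma coset_actionE Hs g a b : coset_action G Hs g a b =
  (coset_val a == ((coset_val b).1, (g *: (coset_val b).2)%g))%:R.
Proof. by rewrite mxE. Qed.

(** Permutation matrices are orthogonal, so coset lattices are self-dual. *)
Lemma dual_coset_action Hs : dual_lattice (coset_action G Hs) =1 coset_action G Hs.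
Proof.
move=> g; apply/matrixP => a b; rewrite [LHS]mxE !coset_actionE.
by rewrite coset_act_eq invgK.
Qed.

Lemma coset_action_glattice Hs : is_glattice G (coset_action G Hs).
Proof.
split=> [|g h Gg Gh].
  apply/matrixP => a b; rewrite coset_actionE mxE lcoset1 -surjective_pairing.
  by rewrite (inj_eq (@coset_val_inj _)).
apply/matrixP => a b; rewrite [RHS]mxE coset_actionE.
have [c cP] := coset_basis_index (coset_basis_act Gh (coset_valP b)).
rewrite (bigD1 c) //= !coset_actionE cP eqxx mulr1 big1 => [|d dc].
  by rewrite /= addr0 lcosetM.
by rewrite !coset_actionE -cP (inj_eq (@coset_val_inj _)) (negPf dc) mulr0.
Qed.

Lemma coset_action_permutation Hs : is_permutation G (coset_action G Hs).
Proof.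
split; first exact: coset_action_glattice.
exists 1%:M; split=> [|g Gg]; first exact: unitmx1.
rewrite invmx1 mul1mx mulmx1.
(* [perm_mx] puts the 1 of row [a] in column [f a], so [f] has to be translation by the inverse of
   [g]. *)
have /fin_all_exists [f fP] (a : 'I_(coset_rank G Hs)) :=
  coset_basis_index (coset_basis_act (groupVr Gg) (coset_valP a)).
have f_inj : injective f.
  move=> a b fab; have := fP b; rewrite -fab fP => -[ab1 /lcoset_inj ab2].
  by apply: coset_val_inj; apply/eqP; rewrite -pair_eqE /= ab1 ab2 !eqxx.
apply/existsP; exists (perm f_inj); apply/eqP/matrixP => a b.
by rewrite coset_actionE !mxE permE coset_act_eq -fP (inj_eq (@coset_val_inj _)) eq_sym.
Qed.

Lemma dual_coset_action_permutation Hs :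
  is_permutation G (dual_lattice (coset_action G Hs)).
Proof.
have [_ [P [uP permP]]] := coset_action_permutation Hs.
split; first exact/dual_glattice/coset_action_glattice.
by exists P; split=> // g Gg; rewrite dual_coset_action permP.
Qed.

(* A vector of the coset lattice, read as a family of functions on [G], the
   [i]-th one being constant on left cosets of the [i]-th subgroup. *)
Definition ccoef Hs (x : 'cV[int]_(coset_rank G Hs)) (i : nat) (g : gT) : int :=
  \sum_(a : 'I_(coset_rank G Hs) | ((coset_val a).1 == i :> nat) &&
            ((coset_val a).2 == (g *: nth 1%G Hs i)%g)) x a 0.

(** This inverts [ccoef] only on functions constant on the left cosets concerned, since values are
    sampled at [repr]. *)
Definition of_coef Hs (f : nat -> gT -> int) : 'cV[int]_(coset_rank G Hs) :=
  \col_(a < coset_rank G Hs) f (coset_val a).1 (repr (coset_val a).2).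

Lemma coset_index_eq Hs (a b : 'I_(coset_rank G Hs)) :
  (a == b) = ((coset_val a).1 == (coset_val b).1 :> nat) &&
             ((coset_val a).2 == (coset_val b).2).
Proof. by rewrite -[LHS](inj_eq (@coset_val_inj _)) -pair_eqE. Qed.

Lemma ccoefE Hs (x : 'cV[int]_(coset_rank G Hs)) (a : 'I_(coset_rank G Hs)) i g :
  (coset_val a).1 = i :> nat -> (coset_val a).2 = (g *: nth 1%G Hs i)%g ->
  ccoef x i g = x a 0.
Proof.
move=> a1 a2; rewrite /ccoef (big_pred1 a) // => b.
by rewrite /= coset_index_eq a1 a2.
Qed.

Lemma ccoef_index Hs i g : (i < size Hs)%N -> g \in G ->
  exists a : 'I_(coset_rank G Hs),
    (coset_val a).1 = i :> nat /\ (coset_val a).2 = (g *: nth 1%G Hs i)%g.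
Proof.
move=> lt_i Gg.
have [|a aP] := @coset_basis_index Hs (Ordinal lt_i, (g *: nth 1%G Hs i)%g).
  by rewrite inE /=; apply/lcosetsP; exists g.
by exists a; rewrite aP.
Qed.

Lemma index_coef Hs (a : 'I_(coset_rank G Hs)) :
  exists2 g, g \in G & (coset_val a).2 = (g *: nth 1%G Hs (coset_val a).1)%g.
Proof. by have := coset_valP a; rewrite inE => /lcosetsP. Qed.

Lemma ccoefP Hs (x y : 'cV[int]_(coset_rank G Hs)) :
  (forall i g, (i < size Hs)%N -> g \in G -> ccoef x i g = ccoef y i g) -> x = y.
Proof.
move=> xy; apply/colP => a; have [g Gg a2] := index_coef a.
by rewrite -(ccoefE x erefl a2) -(ccoefE y erefl a2) xy.
Qed.

Lemma ccoefJ Hs (x : 'cV[int]_(coset_rank G Hs)) i g h :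
  h \in nth 1%G Hs i -> ccoef x i (g * h)%g = ccoef x i g.
Proof. by move=> Hh; rewrite /ccoef lcosetM lcoset_id. Qed.

Lemma ccoef_of_coef Hs f i g :
  (forall h, h \in nth 1%G Hs i -> f i (g * h)%g = f i g) ->
  (i < size Hs)%N -> g \in G -> ccoef (of_coef Hs f) i g = f i g.
Proof.
move=> fH lt_i Gg; have [a [a1 a2]] := ccoef_index lt_i Gg.
rewrite (ccoefE _ a1 a2) mxE a1 a2.
have /lcosetP [h Hh ->] := mem_repr _ (lcoset_refl (nth 1%G Hs i) g).
exact: fH.
Qed.

Lemma ccoefD Hs (x y : 'cV[int]_(coset_rank G Hs)) i g :
  ccoef (x + y) i g = ccoef x i g + ccoef y i g.
Proof. by rewrite -big_split; apply: eq_bigr => a _; rewrite mxE. Qed.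

Lemma ccoefZ Hs c (x : 'cV[int]_(coset_rank G Hs)) i g :
  ccoef (c *: x) i g = c * ccoef x i g.
Proof. by rewrite mulr_sumr; apply: eq_bigr => a _; rewrite mxE. Qed.

Lemma ccoef0 Hs i g : ccoef (0 : 'cV[int]_(coset_rank G Hs)) i g = 0.
Proof. by rewrite /ccoef big1 // => a _; rewrite mxE. Qed.

Lemma ccoefB Hs (x y : 'cV[int]_(coset_rank G Hs)) i g :
  ccoef (x - y) i g = ccoef x i g - ccoef y i g.
Proof. by rewrite ccoefD -scaleN1r ccoefZ mulN1r. Qed.

Lemma ccoef_act Hs k (x : 'cV[int]_(coset_rank G Hs)) i g :
  (i < size Hs)%N -> k \in G -> g \in G ->
  ccoef (coset_action G Hs k *m x) i g = ccoef x i (k^-1 * g)%g.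
Proof.
move=> lt_i Gk Gg; have [a [a1 a2]] := ccoef_index lt_i Gg.
have [b [b1 b2]] := ccoef_index lt_i (groupM (groupVr Gk) Gg).
rewrite (ccoefE _ a1 a2) (ccoefE _ b1 b2) mxE (bigD1 b) //=.
have ab : coset_val b = ((coset_val a).1, (k^-1 *: (coset_val a).2)%g).
  rewrite [LHS]surjective_pairing b2 a2 lcosetM; congr pair.
  by apply: val_inj; rewrite /= a1 b1.
rewrite !coset_actionE coset_act_eq ab eqxx mul1r big1 ?addr0 // => c cb.
by rewrite !coset_actionE coset_act_eq -ab (inj_eq (@coset_val_inj _)) (negPf cb) mul0r.
Qed.

Definition coset_vec Hs i k : 'cV[int]_(coset_rank G Hs) :=
  of_coef Hs (fun j g => ((j == i) && (g *: nth 1%G Hs j == k *: nth 1%G Hs j)%g)%:R).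

Lemma ccoef_coset_vec Hs i k j g : (j < size Hs)%N -> g \in G ->
  ccoef (coset_vec Hs i k) j g =
    ((j == i) && (g *: nth 1%G Hs j == k *: nth 1%G Hs j)%g)%:R.
Proof.
move=> lt_j Gg; rewrite ccoef_of_coef // => h Hh.
by rewrite lcosetM lcoset_id.
Qed.

Lemma coset_vec_eq Hs i g k :
  (g *: nth 1%G Hs i = k *: nth 1%G Hs i)%g -> coset_vec Hs i g = coset_vec Hs i k.
Proof.
move=> gk; apply: ccoefP => j l lt_j Gl; rewrite !ccoef_coset_vec //.
by case: eqP => [->|//]; rewrite gk.
Qed.

Lemma delta_coset_vec Hs (a : 'I_(coset_rank G Hs)) :
  exists2 g, g \in G & delta_mx a 0 = coset_vec Hs (coset_val a).1 g.
Proof.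
have [g Gg a2] := index_coef a; exists g => //.
apply: ccoefP => j k lt_j Gk; have [b [b1 b2]] := ccoef_index lt_j Gk.
rewrite ccoef_coset_vec // (ccoefE _ b1 b2) mxE eqxx andbT.
rewrite coset_index_eq b1.
by case: eqP => //= jE; rewrite a2 b2 jE.
Qed.

(* The vectors of augmentation 0 are spanned by differences of cosets. *)
Lemma aug_ker_span Hs n (A : 'M[int]_(coset_rank G Hs, n)) v :
  (forall i g, (i < size Hs)%N -> g \in G ->
     exists x : 'cV[int]_n, coset_vec Hs i g - v = A *m x) ->
  forall y, coset_aug G Hs *m y = 0 -> exists x : 'cV[int]_n, y = A *m x.
Proof.
move=> spanA y; have sum_y : \sum_a y a 0 = (coset_aug G Hs *m y) 0 0.
  by rewrite mxE; apply: eq_bigr => a _; rewrite mxE mul1r.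
move=> y0; rewrite y0 mxE in sum_y.
have /fin_all_exists [x xP] a : exists x : 'cV[int]_n, delta_mx a 0 - v = A *m x.
  by have [g Gg ->] := delta_coset_vec a; apply: spanA.
(* The coefficients of [y] sum to 0, so the multiples of [v] cancel. *)
exists (\sum_a y a 0 *: x a); rewrite mulmx_sumr.
under eq_bigr => a _ do rewrite -scalemxAr -xP scalerBr.
rewrite sumrB -scaler_suml sum_y scale0r subr0 [LHS]matrix_sum_delta.
by apply: eq_bigr => a _; rewrite big_ord1.
Qed.

(** With subgroups of common order [n], a sum over [G] counts each coset [n] times. *)
Lemma aug_coef Hs n (y : 'cV[int]_(coset_rank G Hs)) :
  (forall i, (i < size Hs)%N ->
     (nth 1%G Hs i \subset G) && (#|nth 1%G Hs i| == n)) ->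
  \sum_(i < size Hs) \sum_(g in G) ccoef y i g = (coset_aug G Hs *m y) 0 0 *+ n.
Proof.
move=> Hn; rewrite mxE -sumrMnl.
under eq_bigr => i _ do rewrite (exchange_big_dep predT) //=.
rewrite exchange_big /=; apply: eq_bigr => a _; rewrite mxE mul1r.
have [k Gk a2] := index_coef a.
rewrite (bigD1 (coset_val a).1) //= [X in _ + X]big1 => [|i ia]; last first.
  by rewrite big_pred0 // => g; rewrite -[_ == i :> nat]/(_ == i) eq_sym (negPf ia) andbF.
have /andP [HG /eqP <-] := Hn _ (ltn_ord (coset_val a).1).
rewrite addr0 -(card_lcoset _ k) -sumr_const; apply: eq_bigl => g.
rewrite eqxx a2 /=; apply/andP/idP => [[_ /eqP ->]|]; first exact: lcoset_refl.
move=> gk; split; last by apply/eqP/esym/lcoset_eqP.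
by have /lcosetP [h Hh ->] := gk; rewrite groupM // (subsetP HG).
Qed.

(** Linearity of [Phi] yields the matrix; right invariance under the target subgroups makes the
    choice of coset representatives immaterial. *)
Lemma coset_map Hs Hs' (Phi : (nat -> gT -> int) -> nat -> gT -> int) :
  (forall c (x y : 'cV[int]_(coset_rank G Hs)) i g,
     Phi (ccoef (c *: x + y)) i g = c * Phi (ccoef x) i g + Phi (ccoef y) i g) ->
  (forall (x : 'cV[int]_(coset_rank G Hs)) i g h, (i < size Hs')%N -> g \in G ->
     h \in nth 1%G Hs' i -> Phi (ccoef x) i (g * h)%g = Phi (ccoef x) i g) ->
  exists A : 'M[int]_(coset_rank G Hs', coset_rank G Hs),
    forall x i g, (i < size Hs')%N -> g \in G ->
      ccoef (A *m x) i g = Phi (ccoef x) i g.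
Proof.
move=> PhiL PhiH.
have [|A AE] := @linear_colP _ _ _ (fun x => of_coef Hs' (Phi (@ccoef Hs x))).
  by move=> c x y; apply/colP => a; rewrite !mxE PhiL.
exists A => x i g lt_i Gg; rewrite AE ccoef_of_coef // => h.
exact: PhiH.
Qed.

Lemma coset_map_equivariant Hs Hs' (A : 'M[int]_(coset_rank G Hs', coset_rank G Hs)) :
  (forall x i g k, (i < size Hs')%N -> g \in G -> k \in G ->
     ccoef (A *m (coset_action G Hs k *m x)) i g = ccoef (A *m x) i (k^-1 * g)%g) ->
  equivariant G (coset_action G Hs) (coset_action G Hs') A.
Proof.
move=> eqvA k Gk; apply: mulmx_colP => x; rewrite -!mulmxA.
by apply: ccoefP => i g lt_i Gg; rewrite eqvA // ccoef_act.
Qed.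

(** In a finite group inverses are products of generators, so right multiplication by generators
    suffices. *)
Lemma gen_ind (S : {set gT}) (P : gT -> Prop) :
  P 1%g -> (forall g h, g \in <<S>>%g -> h \in S -> P g -> P (g * h)%g) ->
  forall g, g \in <<S>>%g -> P g.
Proof.
move=> P1 PM g /gen_prodgP [n [c cS ->]].
elim: n c cS => [|n IH] c cS; first by rewrite big_ord0.
rewrite big_ord_recr /=; apply: PM => //; last by apply: IH => i; apply: cS.
by apply: group_prod => i _; rewrite mem_gen.
Qed.

Lemma right_inv_gen (S : {set gT}) (f : gT -> int) : S \subset G ->
  (forall g h, g \in G -> h \in S -> f (g * h)%g = f g) ->
  forall g h, g \in G -> h \in <<S>>%g -> f (g * h)%g = f g.
Proof.
move=> sSG fS g + Gg; apply: gen_ind => [|h k Sh Sk IH]; first by rewrite mulg1.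
rewrite mulgA fS // groupM //.
by apply: (subsetP (_ : <<S>>%g \subset G)) Sh; rewrite gen_subG.
Qed.

End CosetLattice.

(** * The dihedral group: relations and orders of elements *)

Section Dihedral.
Variables (m : nat) (gT : finGroupType) (G : {group gT}) (s t : gT).
Hypothesis odd_m : odd m.
Hypothesis defG : G = <<[set s; t]>>%G :> {set gT}.
Hypothesis s2m : (s ^+ (2 * m) = 1)%g.
Hypothesis t2 : (t ^+ 2 = 1)%g.
Hypothesis tst : (t * s * t^-1 = s^-1)%g.
Hypothesis cardG : #|G| = (2 * (2 * m))%N.

Let z := (s ^+ m)%g.
Let h := (s ^+ uphalf m)%g.

Let m_half : m%:R = 1 + 2%:R * (m./2)%:R :> int.
Proof. by rewrite -[in LHS](odd_double_half m) odd_m natrD -mul2n natrM. Qed.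

Let sG : s \in G. Proof. by rewrite defG mem_gen // !inE eqxx. Qed.
Let tG : t \in G. Proof. by rewrite defG mem_gen // !inE eqxx orbT. Qed.
Let zG : z \in G. Proof. exact: groupX. Qed.
Let hG : h \in G. Proof. exact: groupX. Qed.

Let tt : (t * t = 1)%g. Proof. by rewrite -expg2. Qed.
Let tV : (t^-1 = t)%g. Proof. by apply/eqP; rewrite eq_invg_mul tt. Qed.
Let zz : (z * z = 1)%g. Proof. by rewrite -expgD addnn -mul2n. Qed.
Let zV : (z^-1 = z)%g. Proof. by apply/eqP; rewrite eq_invg_mul zz. Qed.

Let t_expg i : (t * s ^+ i = s ^- i * t)%g.
Proof.
have -> : (s ^- i = (s ^+ i) ^ t^-1)%g.
  by rewrite -expVgn conjXg -tst conjgE invgK mulgA.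
by rewrite conjgE invgK -!mulgA mulVg mulg1.
Qed.

Let tz : (t * z = z * t)%g. Proof. by rewrite t_expg -/z zV. Qed.
Let hz : (h * z = z * h)%g. Proof. by rewrite -!expgD addnC. Qed.
Let th : (t * h = h^-1 * t)%g. Proof. exact: t_expg. Qed.
Let hh : (h * h = s * z)%g.
Proof. by rewrite -expgD -expgS; congr (_ ^+ _)%g; lia. Qed.

(** Otherwise [G] would be contained in [<[s]>], whose order is at most half that of [G]. *)
Let t_notin_s : t \notin <[s]>%g.
Proof.
apply/negP => ts; have : (#|G| <= 2 * m)%N.
  apply: leq_trans (_ : #|<[s]>%g| <= _)%N; last first.
    by rewrite -orderE; apply: dvdn_leq; [lia | rewrite order_dvdn s2m].
  rewrite subset_leq_card // defG gen_subG; apply/subsetP => x.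
  by rewrite !inE => /orP [] /eqP ->; rewrite ?cycle_id.
by rewrite cardG; lia.
Qed.

Let G_decomp g : g \in G -> exists i, g = (s ^+ i)%g \/ g = (s ^+ i * t)%g.
Proof.
rewrite defG; move: g; apply: gen_ind => [|g k _]; first by exists 0%N; left.
rewrite !inE => /orP [] /eqP -> [i [->|->]].
- by exists i.+1; left; rewrite expgSr.
(* Moving [s] to the left of [t] inverts it, and [(2 * m).-1] is a natural exponent for the inverse
   of [s]. *)
- exists (i + (2 * m).-1)%N; right; rewrite -mulgA -[s in LHS]expg1 t_expg mulgA.
  congr (_ * t)%g; rewrite expgD; congr (_ * _)%g; apply/eqP.
  by rewrite expg1 eq_invg_mul -expgS prednK ?s2m //; lia.
- by exists i; right.
by exists i; left; rewrite -mulgA tt mulg1.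
Qed.

(** If [z] were trivial, [<[s]>] would have order at most m, and its product with [<[t]>], which
    covers [G], at most 2m elements. *)
Let orderz : #|<[z]>%g| = 2%N.
Proof.
apply: nt_prime_order => //.
apply/eqP => z1.
have os : (#|<[s]>%g| <= m)%N.
  by rewrite -orderE; apply: dvdn_leq; [lia | rewrite order_dvdn -/z z1].
have ot : (#|<[t]>%g| <= 2)%N by rewrite -orderE; apply: dvdn_leq; rewrite ?order_dvdn ?t2.
have : (#|G| <= #|<[s]>%g| * #|<[t]>%g|)%N.
  rewrite mul_cardG; apply: leq_trans (leq_pmulr _ (cardG_gt0 _)).
  apply/subset_leq_card/subsetP => g /G_decomp [i [->|->]].
    by rewrite -[(_ ^+ _)%g]mulg1 mem_mulg ?mem_cycle ?group1.
  by rewrite mem_mulg ?mem_cycle ?cycle_id.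
by rewrite cardG; nia.
Qed.

Let ordert : #|<[t]>%g| = 2%N.
Proof.
apply: nt_prime_order => //.
by apply: contraNneq t_notin_s => ->; apply: group1.
Qed.

(** * The two maps of the sequence on coefficient functions *)

Let Rs := [:: 1%G; <<[set t; z]>>%G; <[z]>%G; G].
Let Fs := [:: <[(t * z)%g]>%G; <<[set t; z]>>%G; <[s]>%G].
Let Is := [:: <[z]>%G; <[t]>%G].

(* The equivariant map that sends the generator of Z[G] to <z> - <t>, that of
   Z[G/<t,z>] to the sum of the <z>-cosets in <t,z> minus the sum of its
   <t>-cosets, that of Z[G/<z>] to h<z> - th<z>, and Z to 0. *)
Let Phi_pi (c : nat -> gT -> int) (i : nat) (g : gT) : int :=
  if i is 0%N then
    c 0%N g + c 0%N (g * z)%g + c 1%N g + c 2%N (g * h^-1)%g - c 2%N (g * h^-1 * t)%g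
  else - (c 0%N g + c 0%N (g * t)%g + c 1%N g).

(* The generator of Z[G/<tz>] goes to 1 + tz minus the generator of Z[G/<t,z>];
   that of Z[G/<t,z>] to (1 + t)<z> plus the generator of Z; that of Z[G/<s>] to
   the sum of the cosets of s^i, i < m, in Z[G/<z>] and Z[G/<t,z>], minus the sum
   of <s> in Z[G], plus m./2 times the generator of Z.  The coefficients on Z are chosen
   so that 2 * m./2 - m is a unit, which is where m odd makes iota injective. *)
Let Phi_iota (c : nat -> gT -> int) (i : nat) (g : gT) : int :=
  match i with
  | 0 => c 0%N g - c 2%N g
  | 1 => c 2%N g + c 2%N (g * t)%g - c 0%N g - c 0%N (g * z)%g
  | 2 => c 1%N g + c 2%N g
  | _ => \sum_(i < m) c 1%N (s ^+ i)%g + (m./2)%:R * (c 2%N 1%g + c 2%N t)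
  end.

(** A generator sent to a coset x K contributes to the value at [g] the coefficients of the cosets
    making up g K x^-1; hence the factors h^-1 and h^-1 t = (t h)^-1 in [Phi_pi]. *)
Let pi_spec (P : 'M[int]_(coset_rank G Is, coset_rank G Rs)) :=
  forall x i g, (i < 2)%N -> g \in G -> ccoef (P *m x) i g = Phi_pi (ccoef x) i g.

Let iota_spec (N : 'M[int]_(coset_rank G Rs, coset_rank G Fs)) :=
  forall x i g, (i < 4)%N -> g \in G -> ccoef (N *m x) i g = Phi_iota (ccoef x) i g.

Let vec Hs := 'cV[int]_(coset_rank G Hs).

(** * Right invariance of the coefficients under the stabilizers *)

Let R1t (x : vec Rs) g : ccoef x 1 (g * t)%g = ccoef x 1 g.
Proof. by apply: ccoefJ; rewrite mem_gen // !inE eqxx. Qed.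
Let R1z (x : vec Rs) g : ccoef x 1 (g * z)%g = ccoef x 1 g.
Proof. by apply: ccoefJ; rewrite mem_gen // !inE eqxx orbT. Qed.
Let R2z (x : vec Rs) g : ccoef x 2 (g * z)%g = ccoef x 2 g.
Proof. by apply: ccoefJ; rewrite cycle_id. Qed.
Let R3g (x : vec Rs) g : g \in G -> ccoef x 3 g = ccoef x 3 1%g.
Proof. by move=> Gg; rewrite -[g]mul1g; apply: ccoefJ. Qed.
Let F0tz (x : vec Fs) g : ccoef x 0 (g * t * z)%g = ccoef x 0 g.
Proof. by rewrite -mulgA; apply: ccoefJ; rewrite cycle_id. Qed.
Let F0t (x : vec Fs) g : ccoef x 0 (g * t)%g = ccoef x 0 (g * z)%g.
Proof. by rewrite -[LHS]F0tz -(mulgA g) tt mulg1. Qed.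
Let F1t (x : vec Fs) g : ccoef x 1 (g * t)%g = ccoef x 1 g.
Proof. by apply: ccoefJ; rewrite mem_gen // !inE eqxx. Qed.
Let F1z (x : vec Fs) g : ccoef x 1 (g * z)%g = ccoef x 1 g.
Proof. by apply: ccoefJ; rewrite mem_gen // !inE eqxx orbT. Qed.
Let F2X (x : vec Fs) g i : ccoef x 2 (g * s ^+ i)%g = ccoef x 2 g.
Proof. by apply: ccoefJ; rewrite mem_cycle. Qed.
Let F2XV (x : vec Fs) g i : ccoef x 2 (g * s ^- i)%g = ccoef x 2 g.
Proof. by apply: ccoefJ; rewrite groupV mem_cycle. Qed.

(** The s^i with i < m represent the cosets of <t, z>, which left translation by [k] permutes; this
    is checked on the generators. *)
Let sum_V4 (f : gT -> int) k :
  (forall g, g \in G -> f (g * t)%g = f g) ->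
  (forall g, g \in G -> f (g * z)%g = f g) -> k \in G ->
  \sum_(i < m) f (k * s ^+ i)%g = \sum_(i < m) f (s ^+ i)%g.
Proof.
move=> ft fz; rewrite defG.
have fS (f' : gT -> int) : (forall g, g \in G -> f' (g * z)%g = f' g) ->
    \sum_(i < m) f' (s ^+ i.+1)%g = \sum_(i < m) f' (s ^+ i)%g.
  move=> f'z; have m0 : (0 < m)%N by lia.
  rewrite -(prednK m0) big_ord_recr big_ord_recl /= addrC prednK //.
  by congr (_ + _); rewrite -/z -[z]mul1g f'z.
move: k; apply: gen_ind => [|k l Gk Sl <-]; first by under eq_bigr do rewrite mul1g.
rewrite -defG in Gk.
have fkz g : g \in G -> f (k * (g * z))%g = f (k * g)%g.
  by move=> Gg; rewrite mulgA fz // groupM.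
move: Sl; rewrite !inE => /orP [] /eqP ->.
  rewrite -[RHS](fS (fun g => f (k * g)%g)) //.
  by apply: eq_bigr => i _; rewrite expgS mulgA.
(* Here [t] turns s^i into s^-i, and s^-i z = s^(m-i), so the shifted sum is traversed backwards. *)
rewrite -[RHS](fS (fun g => f (k * g)%g)) // [RHS](reindex_inj rev_ord_inj).
apply: eq_bigr => i _ /=; rewrite -mulgA t_expg mulgA ft ?groupM ?groupV ?groupX //.
rewrite -[LHS]fz ?groupM ?groupV ?groupX // -mulgA; congr (f (k * _)%g).
apply: (mulgI (s ^+ i)%g); rewrite mulKVg -expgD /z; congr (_ ^+ _)%g.
by have := ltn_ord i; lia.
Qed.

(** * Well-definedness and equivariance of the maps *)

Let pi_map : exists P, pi_spec P.
Proof.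
apply: coset_map => [c x y [|i] g|x [|[|//]] g k _ Gg].
- by rewrite /= !ccoefD !ccoefZ; ring.
- by rewrite /= !ccoefD !ccoefZ; ring.
- move: g k Gg; apply: right_inv_gen; first by rewrite sub1set.
  move=> g k _ /set1P -> /=.
  rewrite R1z -!(mulgA g z) zz mulg1.
  have zh : (z * h^-1 = h^-1 * z)%g.
    by apply: (mulgI h); apply: (mulIg h); rewrite mulgA hz -!mulgA mulVg mulg1 mulKVg.
  by rewrite -!(mulgA g) zh !mulgA -(mulgA _ z t) -tz mulgA !R2z; ring.
move: g k Gg; apply: right_inv_gen; first by rewrite sub1set.
by move=> g k _ /set1P -> /=; rewrite R1t -(mulgA g) tt mulg1; ring.
Qed.

Let iota_map : exists N, iota_spec N.
Proof.
apply: coset_map => [c x y [|[|[|i]]] g|x [|[|[|[|//]]]] g k _ Gg].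
- by rewrite /= !ccoefD !ccoefZ; ring.
- by rewrite /= !ccoefD !ccoefZ; ring.
- by rewrite /= !ccoefD !ccoefZ; ring.
- rewrite /=; under eq_bigr do rewrite ccoefD ccoefZ.
  by rewrite big_split -mulr_sumr /= !ccoefD !ccoefZ; ring.
- by move/set1gP => ->; rewrite mulg1.
- move: g k Gg; apply: right_inv_gen.
    by apply/subsetP => g; rewrite !inE => /orP [] /eqP ->.
  move=> g k _; rewrite !inE => /orP [] /eqP -> /=.
    by rewrite F0tz F0t -(mulgA g) tt mulg1; ring.
  rewrite -!(mulgA g) zz mulg1 -tz mulgA.
  by rewrite !(F2X _ _ m); ring.
- move: g k Gg; apply: right_inv_gen; first by rewrite sub1set.
  by move=> g k _ /set1P -> /=; rewrite F1z (F2X _ _ m).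
by [].
Qed.

Let pi_equivariant P :
  pi_spec P ->
  equivariant G (coset_action G Rs) (coset_action G Is) P.
Proof.
move=> PE; apply: coset_map_equivariant => x i g k lt_i Gg Gk.
rewrite !PE ?groupM ?groupV //.
by case: i lt_i => [|i] _ /=; rewrite !ccoef_act ?mulgA ?groupM ?groupV.
Qed.

(** The elements [k] and [k * t] represent the two cosets of [<[s]>], in one order or the other. *)
Let F2sum (x : vec Fs) k : k \in G ->
  ccoef x 2 k + ccoef x 2 (k * t)%g = ccoef x 2 1%g + ccoef x 2 t.
Proof.
have F2s i : ccoef x 2 (s ^+ i)%g = ccoef x 2 1%g by rewrite -(F2X x 1 i) mul1g.
have F2st i : ccoef x 2 (s ^+ i * t)%g = ccoef x 2 t.
  by rewrite -(F2X x _ i) -mulgA t_expg mulKVg.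
move=> /G_decomp [i [->|->]]; first by rewrite F2s F2st.
by rewrite -(mulgA _ t) tt mulg1 F2s F2st addrC.
Qed.

Let iota_equivariant N :
  iota_spec N ->
  equivariant G (coset_action G Fs) (coset_action G Rs) N.
Proof.
move=> NE; apply: coset_map_equivariant => x i g k lt_i Gg Gk.
rewrite !NE ?groupM ?groupV //.
case: i lt_i => [|[|[|j]]] _ /=; rewrite ?ccoef_act ?mulgA ?groupM ?groupV //.
(* The component on Z must be fixed by the action: it is built from the total coefficients over
   G/<t, z> and G/<s>. *)
under eq_bigr => i _ do rewrite ccoef_act ?groupX //.
by rewrite (@sum_V4 (ccoef x 1)) ?groupV // mulg1 F2sum ?groupV.
Qed.

(** * Exactness at the kernel and at the middle term *)

Let pi_iota P N :
  pi_spec P -> iota_spec N ->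
  forall w : vec Fs, P *m (N *m w) = 0.
Proof.
move=> PE NE w; apply: ccoefP => i g lt_i Gg; rewrite ccoef0 PE //.
case: i lt_i => [|i] _ /=; rewrite !NE ?groupM ?groupV //=.
  rewrite F1t (F2XV _ _ (uphalf m)) (F2X _ _ m).
  have -> : (g * h^-1 * t = g * t * h)%g by rewrite -!mulgA th.
  by rewrite (F2X _ _ (uphalf m)); ring.
by rewrite F0t; ring.
Qed.

(** Components 0 and 2 express [w] by its part on Z[G/<s>]; invariance under tz passes to that part
    and makes it constant, and the Z-component is minus this constant. *)
Let iota_inj N :
  iota_spec N ->
  forall w : vec Fs, N *m w = 0 -> w = 0.
Proof.
move=> NE w Nw0.
have N0 i g : (i < 4)%N -> g \in G -> Phi_iota (ccoef w) i g = 0.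
  by move=> lt_i Gg; rewrite -NE // Nw0 ccoef0.
have w0 g : g \in G -> ccoef w 0 g = ccoef w 2 g.
  by move=> Gg; have /= := N0 0%N g isT Gg; lia.
have w1 g : g \in G -> ccoef w 1 g = - ccoef w 2 g.
  by move=> Gg; have /= := N0 2%N g isT Gg; lia.
have w2t g : g \in G -> ccoef w 2 (g * t)%g = ccoef w 2 g.
  by move=> Gg; rewrite -[in RHS]w0 // -(F0tz w g) w0 ?groupM // (F2X _ _ m).
have w2c g : g \in G -> ccoef w 2 g = ccoef w 2 1%g.
  by move=> Gg; have := F2sum w Gg; rewrite w2t // -(w2t 1%g) // mul1g; lia.
have w20 : ccoef w 2 1%g = 0.
  have /= := N0 3%N 1%g isT (group1 G).
  rewrite (w2c t) //; under eq_bigr => i _ do rewrite w1 ?groupX // w2c ?groupX //.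
  rewrite sumr_const card_ord -[_ *+ m]mulr_natl => E.
  have : - (ccoef w 2 1%g) = 0 by rewrite -E m_half; ring.
  by move/eqP; rewrite oppr_eq0 => /eqP.
apply: ccoefP => i g lt_i Gg; rewrite ccoef0.
by case: i lt_i => [|[|[|//]]] _; rewrite ?w0 ?w1 // w2c // w20 ?oppr0.
Qed.

(** In a preimage, components 0 and 2 of [Phi_iota] leave only the part [F] on Z[G/<s>] free and
    force F g - F (g t) = X g; the main point is that [X] is invariant under [<[s]>]. *)
Let ker_pi P N :
  pi_spec P -> iota_spec N ->
  forall x : vec Rs, P *m x = 0 -> exists w : vec Fs, x = N *m w.
Proof.
move=> PE NE x Px0.
have P0 i g : (i < 2)%N -> g \in G -> Phi_pi (ccoef x) i g = 0.
  by move=> lt_i Gg; rewrite -PE // Px0 ccoef0.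
pose X g : int := ccoef x 2 g - ccoef x 2 (g * t)%g.
have Xt g : X (g * t)%g = - X g by rewrite /X -(mulgA g) tt mulg1 opprB.
have Xz g : X (g * z)%g = X g.
  by rewrite /X -(mulgA g) -tz mulgA !R2z.
have Ea g : g \in G ->
    ccoef x 0 g + ccoef x 0 (g * z)%g + ccoef x 1 g + X (g * h^-1)%g = 0.
  by move=> Gg; rewrite -[RHS](P0 0%N g isT Gg) /X /=; ring.
have Eb g : g \in G -> ccoef x 1 g = - (ccoef x 0 g + ccoef x 0 (g * t)%g).
  by move=> Gg; rewrite -[LHS]addr0 -(P0 1%N g isT Gg) /=; ring.
(* Comparing the equations at gh and ght gives X (g * h * h) = X g, and
   h * h = s * z. *)
have Xs g : g \in G -> X (g * s)%g = X g.
  move=> Gg; have Ggh := groupM Gg hG.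
  have := Ea _ Ggh; have := Ea _ (groupM Ggh tG).
  have := Eb _ Ggh; have := Eb _ (groupM Ggh zG).
  rewrite R1t R1z mulgK.
  have -> : (g * h * z * t = g * h * t * z)%g by rewrite -!mulgA tz.
  have -> : (g * h * t * h^-1 = g * s * z * t)%g.
    have thV : (t * h^-1 = h * t)%g by apply: (mulIg h); rewrite mulgKV -mulgA th mulKVg.
    by rewrite -(mulgA _ t) thV !mulgA -(mulgA g h) hh mulgA.
  rewrite Xt Xz; move: (ccoef x 0 _) (ccoef x 0 _) (ccoef x 0 _) (ccoef x 0 _).
  by move: (ccoef x 1 _) (X _) (X _); lia.
have XS g k : g \in G -> k \in <[s]>%g -> X (g * k)%g = X g.
  move=> Gg; apply: (right_inv_gen (G := G)) Gg; first by rewrite sub1set.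
  by move=> a b Ga /set1P ->; apply: Xs.
have X1 i : X (s ^+ i)%g = X 1%g by rewrite -(mul1g (s ^+ i)%g) XS ?group1 ?mem_cycle.
(* The value at 1 of the <s>-invariant component of the preimage is forced by
   the Z-component, since 2 * m./2 - m = -1. *)
pose f1 : int := \sum_(i < m) ccoef x 2 (s ^+ i)%g - (m./2)%:R * X 1%g - ccoef x 3 1%g.
pose F g : int := if g \in <[s]>%g then f1 else f1 - X 1%g.
have FS g k : k \in <[s]>%g -> F (g * k)%g = F g.
  by move=> sk; rewrite /F groupMr.
have Ft g : g \in G -> F (g * t)%g = F g - X g.
  move=> /G_decomp [i [->|->]]; rewrite /F.
    by rewrite mem_cycle groupMl ?mem_cycle // (negPf t_notin_s) X1.
  rewrite -(mulgA _ t) tt mulg1 mem_cycle groupMl ?mem_cycle // (negPf t_notin_s).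
  by rewrite Xt X1; ring.
have zs : z \in <[s]>%g by rewrite mem_cycle.
(* The defect [X g] is what [F] loses from g to g t z, so [c 0] below is invariant under tz. *)
have E0 g : g \in G -> ccoef x 0 (g * t * z)%g = ccoef x 0 g + X g.
  move=> Gg; have := Ea g Gg; have := Eb _ (groupM Gg zG).
  rewrite XS ?groupV ?mem_cycle // R1z -!(mulgA g) tz.
  move: (ccoef x 0 _) (ccoef x 0 _) (ccoef x 0 _) (ccoef x 1 _) (X _); lia.
(* The first two cases solve components 0 and 2 of [Phi_iota] for given [F]. *)
pose c (i : nat) g : int :=
  match i with
  | 0 => ccoef x 0 g + F g
  | 1 => ccoef x 2 g - F g
  | _ => F g
  end.
pose w := of_coef G Fs c.
have cw i g : (i < 3)%N -> g \in G -> ccoef w i g = c i g.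
  move=> lt_i Gg; apply: ccoef_of_coef => // k; case: i lt_i => [|[|[|//]]] _ /=.
  - apply: (right_inv_gen (G := G) (f := c 0%N)) Gg; first by rewrite sub1set groupM.
    move=> a b Ga /set1P -> /=; rewrite mulgA E0 // FS // Ft //; ring.
  - apply: (right_inv_gen (G := G) (f := c 1%N)) Gg.
      by apply/subsetP => a; rewrite !inE => /orP [] /eqP ->.
    move=> a b Ga; rewrite !inE => /orP [] /eqP -> /=; last by rewrite R2z FS.
    by rewrite Ft // /X; ring.
  exact: FS.
exists w; apply: ccoefP => i g lt_i Gg; rewrite NE //.
case: i lt_i => [|[|[|[|//]]]] _ /=; rewrite ?cw ?groupM //=.
- by ring.
- rewrite Ft // FS //; have := Ea g Gg; rewrite XS ?groupV ?mem_cycle //.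
  by move: (ccoef x 0 _) (ccoef x 0 _) (ccoef x 1 _) (X _) (F _); lia.
- by ring.
(* On the powers of [s] the value of [F] is [f1], and at [t] it is f1 - X 1; [m_half] and the choice
   of [f1] then give the Z-component. *)
rewrite R3g //; under eq_bigr => i _ do rewrite cw ?groupX //= /F mem_cycle.
rewrite sumrB sumr_const card_ord -[_ *+ m]mulr_natl.
have := Ft 1%g (group1 G); rewrite mul1g => ->; rewrite /F group1.
by rewrite m_half /f1; ring.
Qed.

(** * The image of the middle term: the vectors of augmentation 0 *)

Let aug_pi P :
  pi_spec P ->
  forall x : vec Rs, coset_aug G Is *m (P *m x) = 0.
Proof.
move=> PE x.
have sum_mulr (f : gT -> int) k : k \in G -> \sum_(g in G) f (g * k)%g = \sum_(g in G) f g.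
  move=> Gk; rewrite [RHS](reindex_inj (mulIg k)).
  by apply: eq_bigl => g; rewrite groupMr.
have sum0 : \sum_(i < 2) \sum_(g in G) ccoef (P *m x) i g = 0.
  rewrite big_ord_recl big_ord1 -big_split /=.
  under eq_bigr => g Gg do rewrite !PE //=.
  rewrite big_split sumrN !big_split sumrN /= !(sum_mulr (ccoef x 0)) //.
  rewrite (sum_mulr (ccoef x 2)) ?groupV //.
  under [X in _ + _ - X + _]eq_bigr do rewrite -mulgA.
  by rewrite (sum_mulr (ccoef x 2)) ?groupM ?groupV //; ring.
(* Both subgroups in [Is] have order 2, so twice the augmentation is the sum just shown to
   vanish. *)
have /= := @aug_coef _ G Is 2 (P *m x); rewrite sum0 => /(_ _)/esym aug0.
have {aug0}/eqP : (coset_aug G Is *m (P *m x)) 0 0 *+ 2 = 0; first apply: aug0.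
  case=> [|[|//]] _ /=; first by rewrite cycle_subG zG orderz.
  by rewrite cycle_subG tG ordert.
rewrite Num.Theory.mulrn_eq0 /= => /eqP aug0.
by apply/matrixP => i j; rewrite !ord1 [RHS]mxE.
Qed.

Let lcoset_eqE (H : {group gT}) g k :
  (g *: H == k *: H)%g = ((k^-1 * g)%g \in H).
Proof.
by rewrite -mem_lcoset; apply/eqP/idP => [<-|/lcoset_eqP //]; apply: lcoset_refl.
Qed.

(** A coset of a subgroup of order 2 has two distinct elements, so its indicator is a sum of two, as
    in the Z[G] terms of [Phi_pi]. *)
Let lcoset_eq2 (a : gT) g k : #|<[a]>%g| = 2%N ->
  ((g *: <[a]> == k *: <[a]>)%g : nat) = ((g == k) + (g * a == k)%g)%N.
Proof.
move=> oa; have a1 : a != 1%g by apply: contra_eq_neq oa => ->; rewrite cycle1 cards1.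
have -> : (g *: <[a]> == k *: <[a]>)%g = ((k^-1 * g)%g \in [set 1%g; a]).
  by rewrite -cycle2g // lcoset_eqE.
have aV : (a * a = 1)%g by rewrite -expg2 -oa expg_order.
rewrite !inE -eq_mulVg1 eq_sym.
have -> : (k^-1 * g == a)%g = (g * a == k)%g.
  by rewrite -[in RHS](inj_eq (mulIg a)) -mulgA aV mulg1 -(inj_eq (mulgI k)) mulKVg.
by case: eqP => [->|] //=; rewrite -{2}[k]mulg1 (inj_eq (mulgI k)) (negPf a1).
Qed.

Let pi_edge P k : pi_spec P -> k \in G ->
  P *m coset_vec G Rs 0 k = coset_vec G Is 0 k - coset_vec G Is 1 k.
Proof.
move=> PE Gk; apply: ccoefP => i g lt_i Gg; rewrite PE // ccoefB.
have e1 l : (l *: 1%G == k *: 1%G)%g = (l == k).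
  by rewrite !mulg1 (inj_eq set1_inj).
case: i lt_i => [|[|//]] _ /=; rewrite !ccoef_coset_vec ?groupM ?groupV //= !e1.
  by rewrite lcoset_eq2 // natrD; ring.
by rewrite lcoset_eq2 // natrD; ring.
Qed.

Let pi_shift P k : pi_spec P -> k \in G ->
  P *m coset_vec G Rs 2 k = coset_vec G Is 0 (k * h)%g - coset_vec G Is 0 (k * t * h)%g.
Proof.
move=> PE Gk; apply: ccoefP => i g lt_i Gg; rewrite PE // ccoefB.
case: i lt_i => [|[|//]] _ /=; rewrite !ccoef_coset_vec ?groupM ?groupV //=.
(* An element commuting with [z] normalizes [<[z]>], so it can be moved across an equality of
   cosets; this is applied to h and t h. *)
have shift (a b c : gT) : (c * z = z * c)%g ->
    (a * c^-1 *: <[z]> == b *: <[z]>)%g = (a *: <[z]> == b * c *: <[z]>)%g.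
  move=> cz; have Nc : c \in 'N(<[z]>)%g.
    by rewrite (subsetP (cent_sub _)) // cent_cycle; apply/cent1P.
  by rewrite !lcoset_eqE -(memJ_norm _ Nc) conjgE invMg -!mulgA mulVg mulg1.
have thz : (t * h * z = z * (t * h))%g by rewrite -mulgA hz !mulgA tz.
by rewrite shift // -(mulgA g) -[t in LHS]tV -invMg shift // mulgA; ring.
Qed.

(** The differences from [pi_edge] and [pi_shift] link every coset to that of 1; induction on words
    in [s] and [t] telescopes them. *)
Let pi_surj P : pi_spec P ->
  forall y : vec Is, coset_aug G Is *m y = 0 -> exists x : vec Rs, y = P *m x.
Proof.
move=> PE; apply: (@aug_ker_span _ G Is _ P (coset_vec G Is 0 1%g)).
have u1t g : coset_vec G Is 1 (g * t)%g = coset_vec G Is 1 g.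
  by apply: coset_vec_eq; rewrite lcosetM lcoset_id ?cycle_id.
have u0z g : coset_vec G Is 0 (g * z)%g = coset_vec G Is 0 g.
  by apply: coset_vec_eq; rewrite lcosetM lcoset_id ?cycle_id.
have u0 g : g \in G -> exists x : vec Rs, coset_vec G Is 0 g - coset_vec G Is 0 1%g = P *m x.
  rewrite {1}defG; move: g; apply: gen_ind => [|g k Gg Sk [x xP]].
    by exists 0; rewrite mulmx0 subrr.
  rewrite -defG in Gg.
  (* The images at [g * t] and [g] share their coset of [<[t]>], which cancels in the difference. *)
  have Pt : P *m (coset_vec G Rs 0 (g * t)%g - coset_vec G Rs 0 g) =
      coset_vec G Is 0 (g * t)%g - coset_vec G Is 0 g.
    rewrite mulmxBr !pi_edge ?groupM // u1t opprB addrA subrK //.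
  move: Sk; rewrite !inE => /orP [] /eqP ->.
    (* Since h h = s z and h t h = t, [pi_shift] at [g * h] leads from the [<[z]>]-coset of g t to
       that of g s. *)
    exists (x + coset_vec G Rs 2 (g * h)%g + (coset_vec G Rs 0 (g * t)%g - coset_vec G Rs 0 g)).
    rewrite mulmxDr Pt mulmxDr -xP pi_shift ?groupM // -(mulgA g h h) hh mulgA u0z.
    have -> : (g * h * t * h = g * t)%g by rewrite -!mulgA th mulKVg.
    apply/matrixP => i j; rewrite !mxE; ring.
  exists (x + (coset_vec G Rs 0 (g * t)%g - coset_vec G Rs 0 g)).
  by rewrite mulmxDr -xP Pt; apply/matrixP => i j; rewrite !mxE; ring.
case=> [|[|//]] g _ Gg; first exact: u0.
have [x xP] := u0 g Gg; exists (x - coset_vec G Rs 0 g).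
by rewrite mulmxBr -xP pi_edge //; apply/matrixP => i j; rewrite !mxE; ring.
Qed.

(** As [rho] is an arbitrary presentation embedded by [A], the map [P] is factored as [A *m Q], and
    the properties of [Q] follow by cancelling the injective [A]. *)
Lemma dihedral_quasi_permutation r (rho : gT -> 'M[int]_r) :
  is_I_lattice G [:: <[(s ^+ m)%g]>%G; <[t]>%G] rho ->
  is_quasi_permutation G (dual_lattice rho).
Proof.
move=> [lat_rho [A [eqvA injA augA]]].
have [P PE] := pi_map; have [N NE] := iota_map.
have [Q PQ] : exists Q, P = A *m Q.
  by apply: col_factor => x; apply/augA/aug_pi.
have injA' n (B C : 'M[int]_(r, n)) : A *m B = A *m C -> B = C.
  move=> AB; apply: mulmx_colP => x; apply/eqP; rewrite -subr_eq0.
  by apply/eqP/injA; rewrite mulmxBr !mulmxA AB subrr.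
apply: (@dual_quasi_permutation _ G _ _ _ rho (coset_action G Rs) (coset_action G Fs) Q N) => //.
- exact: dual_coset_action_permutation.
- exact: dual_coset_action_permutation.
- move=> g Gg; apply: injA'.
  by rewrite !mulmxA -PQ eqvA // -mulmxA -PQ; apply: pi_equivariant.
- exact: iota_equivariant.
- move=> y; have [|x xP] := @pi_surj P PE (A *m y); first by apply/augA; exists y.
  by exists x; apply: injA'; rewrite xP PQ mulmxA.
- exact: iota_inj.
move=> x; split=> [Qx0|[w ->]].
  by apply: (ker_pi PE NE); rewrite PQ -mulmxA Qx0 mulmx0.
by apply: injA'; rewrite mulmxA -PQ mulmx0 pi_iota.
Qed.

End Dihedral.

(* G = D_{2m} = < s, t | s^(2m) = t^2 = 1, t s t^-1 = s^-1 > of order 4m;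
   Hs = { <s^m>, <t> }; every coordinate presentation (r, rho) of I_{G/Hs}
   has quasi-permutation dual J_{G/Hs} = I_{G/Hs}°. *)
Theorem theorem7p1 (m : nat) (gT : finGroupType) (G : {group gT}) (s t : gT)
  (r : nat) (rho : gT -> 'M[int]_r) :
  odd m ->
  G = <<[set s; t]>>%G :> {set gT} ->
  (s ^+ (2 * m))%g = 1%g -> (t ^+ 2)%g = 1%g -> (t * s * t^-1)%g = (s^-1)%g ->
  #|G| = (2 * (2 * m))%N ->
  is_I_lattice G [:: <[(s ^+ m)%g]>%G; <[t]>%G] rho ->
  is_quasi_permutation G (dual_lattice rho).
Proof.
by move=> odd_m defG s2m t2 tst cardG; apply: dihedral_quasi_permutation.
Qed.
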